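(* Fix longitudinal data $(X_i,Y_i)_{i=1}^m$, with $n$ observations per subject, let $\hat\beta_g$ be the full-data GEE estimator and let $r\ge1$ be the subsample size. Put $N=mn^{-1/2}$, $\Phi_0=-N^{-1}\,\partial U(\beta)/\partial\beta\,|_{\beta=\hat\beta_g}$ (invertible), where $U(\beta)=\sum_{i=1}^m D_i^T(\beta)W_i^{-1}(\beta)S_i(\beta)$. For a vector of subsampling probabilities $\pi=(\pi_i)_{i=1}^m$ ($\pi_i\ge0$, $\sum_{i=1}^m\pi_i=1$) let $$V(\pi)=\Phi_0^{-1}\Phi(\pi)(\Phi_0^{-1})^T,\qquad \Phi(\pi)=\frac{1}{rN^2}\sum_{i=1}^m\frac{D_i^T(\hat\beta_g)W_i^{-1}(\hat\beta_g)S_i(\hat\beta_g)S_i^T(\hat\beta_g)W_i^{-1}(\hat\beta_g)D_i(\hat\beta_g)}{\pi_i}.$$ Then the subsampling strategy is mVc-optimal, i.e. $\mathrm{tr}\,V(\pi)$ is minimized over all such $\pi$, if the subsampling probabilities are chosen as $$\pi_i^{\mathrm{mVc}}=\frac{\left\|\Phi_0^{-1}D_i^T(\hat\beta_g)W_i^{-1}(\hat\beta_g)S_i(\hat\beta_g)\right\|_2}{\sum_{k=1}^m\left\|\Phi_0^{-1}D_k^T(\hat\beta_g)W_k^{-1}(\hat\beta_g)S_k(\hat\beta_g)\right\|_2},\qquad i=1,\dots,m.$$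
   Context: Model: for subject $i=1,\dots,m$ and $j=1,\dots,n$, $y_{ij}\in\mathbb{R}$ is a response and $x_{ij}\in\mathbb{R}^p$ a covariate; $\mu_{ij}(\beta)=g(x_{ij}^T\beta)$ with $g$ a known differentiable function and $\beta\in\mathbb{R}^p$; $\nu$ is a known positive variance function and $\phi>0$ a dispersion parameter. $Y_i=(y_{i1},\dots,y_{in})^T$, $X_i=(x_{i1},\dots,x_{in})^T$, $\mu_i=(\mu_{i1},\dots,\mu_{in})^T$, $A_i=\mathrm{diag}(\nu(\mu_{i1}),\dots,\nu(\mu_{in}))$, $W_i=\phi A_i^{1/2}R(\rho)A_i^{1/2}$ with $R(\rho)$ an $n\times n$ working correlation matrix (at given $\rho$), $D_i=\partial\mu_i/\partial\beta$ ($n\times p$), $S_i=Y_i-\mu_i(\beta)$. The full-data GEE estimator $\hat\beta_g$ is a root of $U(\beta)=0$. The matrix $V(\pi)$ is the asymptotic covariance matrix (given the data) of the estimator computed from a with-replacement subsample of size $r$ drawn with probabilities $\pi$. A subsampling strategy is called mVc-optimal if it minimizes $\mathrm{tr}\,V(\pi)$. Conventions: a summand of $\Phi(\pi)$ whose numerator vanishes is $0$ whatever $\pi_i$ is; if a numerator is nonzero and $\pi_i=0$ the trace is $+\infty$. The denominator in the formula for $\pi_i^{\mathrm{mVc}}$ is assumed positive. *)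

(* Defs.v *)
From HB Require Import structures.
From mathcomp Require Import all_boot all_order all_algebra.
From mathcomp Require Import all_classical all_reals all_analysis.
Set Implicit Arguments.
Unset Strict Implicit.
Unset Printing Implicit Defensive.
Import Order.TTheory GRing.Theory Num.Theory.
Import numFieldNormedType.Exports.
Local Open Scope ring_scope.

(* Row j of [covar i] is x_ij^T; [wcorr] is R(rho) at the given rho. *)
Record gee_model (R : realType) (m n p : nat) := GeeModel {
  covar : 'I_m -> 'M[R]_(n, p) ;
  resp : 'I_m -> 'cV[R]_n ;
  link : R -> R ;
  varfun : R -> R ;
  disp : R ;
  wcorr : 'M[R]_n }.

Definition norm2 (R : realType) (p : nat) (v : 'cV[R]_p) : R :=
  Num.sqrt (\sum_k v k 0 ^+ 2).

Definition psd (R : realType) (n : nat) (C : 'M[R]_n) : Prop :=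
  forall v : 'cV[R]_n, 0 <= (v^T *m C *m v) 0 0.

Definition correlation_matrix (R : realType) (n : nat) (C : 'M[R]_n) : Prop :=
  [/\ C^T = C, forall j, C j j = 1 & psd C].

(* d f / d b in the layout with one row per component of f and one column per
   coordinate of b; the library's [jacobian] is the transpose of this and acts
   on row vectors. *)
Definition partials (R : realType) (p q : nat) (f : 'cV[R]_p -> 'cV[R]_q)
    (b : 'cV[R]_p) : 'M[R]_(q, p) :=
  \matrix_(k, l) derive (fun c => f c k 0) b (delta_mx l 0).

Definition has_partials (R : realType) (p q : nat) (f : 'cV[R]_p -> 'cV[R]_q)
    (b : 'cV[R]_p) : Prop :=
  forall k l, derivable (fun c => f c k 0) b (delta_mx l 0).

Definition mean (R : realType) (m n p : nat) (M : gee_model R m n p) (i : 'I_m)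
    (b : 'cV[R]_p) : 'cV[R]_n :=
  \col_j link M ((covar M i *m b) j 0).

Definition Amx (R : realType) (m n p : nat) (M : gee_model R m n p) (i : 'I_m)
    (b : 'cV[R]_p) : 'M[R]_n :=
  diag_mx (\row_j varfun M (mean M i b j 0)).

(* A_i is diagonal with positive entries, so its square root is entrywise. *)
Definition Ahalf (R : realType) (m n p : nat) (M : gee_model R m n p) (i : 'I_m)
    (b : 'cV[R]_p) : 'M[R]_n :=
  map_mx Num.sqrt (Amx M i b).

Definition Wmx (R : realType) (m n p : nat) (M : gee_model R m n p) (i : 'I_m)
    (b : 'cV[R]_p) : 'M[R]_n :=
  disp M *: (Ahalf M i b *m wcorr M *m Ahalf M i b).

Definition Dmx (R : realType) (m n p : nat) (M : gee_model R m n p) (i : 'I_m)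
    (b : 'cV[R]_p) : 'M[R]_(n, p) :=
  partials (mean M i) b.

Definition resid (R : realType) (m n p : nat) (M : gee_model R m n p) (i : 'I_m)
    (b : 'cV[R]_p) : 'cV[R]_n :=
  resp M i - mean M i b.

Definition score (R : realType) (m n p : nat) (M : gee_model R m n p)
    (b : 'cV[R]_p) : 'cV[R]_p :=
  \sum_i (Dmx M i b)^T *m invmx (Wmx M i b) *m resid M i b.

Definition Nconst (R : realType) (m n : nat) : R := m%:R * (Num.sqrt n%:R)^-1.

Definition Phi0 (R : realType) (m n p : nat) (M : gee_model R m n p)
    (b : 'cV[R]_p) : 'M[R]_p :=
  - ((Nconst R m n)^-1 *: partials (score M) b).

Definition Phi_num (R : realType) (m n p : nat) (M : gee_model R m n p)
    (b : 'cV[R]_p) (i : 'I_m) : 'M[R]_p :=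
  (Dmx M i b)^T *m invmx (Wmx M i b) *m resid M i b *m (resid M i b)^T
    *m invmx (Wmx M i b) *m Dmx M i b.

(* Division by pi i = 0 gives 0 here; [trV] accounts for the summands in which
   this is not the intended value. *)
Definition Phi (R : realType) (m n p : nat) (M : gee_model R m n p)
    (b : 'cV[R]_p) (r : nat) (pi : 'I_m -> R) : 'M[R]_p :=
  (r%:R * Nconst R m n ^+ 2)^-1 *: \sum_i (pi i)^-1 *: Phi_num M b i.

Definition V (R : realType) (m n p : nat) (M : gee_model R m n p)
    (b : 'cV[R]_p) (r : nat) (pi : 'I_m -> R) : 'M[R]_p :=
  invmx (Phi0 M b) *m Phi M b r pi *m (invmx (Phi0 M b))^T.

Definition trV (R : realType) (m n p : nat) (M : gee_model R m n p)
    (b : 'cV[R]_p) (r : nat) (pi : 'I_m -> R) : \bar R :=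
  if [exists i, (Phi_num M b i != 0) && (pi i == 0)] then +oo%E
  else (\tr (V M b r pi))%:E.

Definition prob_vector (R : realType) (m : nat) (pi : 'I_m -> R) : Prop :=
  (forall i, 0 <= pi i) /\ \sum_i pi i = 1.

Definition mVc_optimal (R : realType) (m n p : nat) (M : gee_model R m n p)
    (b : 'cV[R]_p) (r : nat) (pi : 'I_m -> R) : Prop :=
  prob_vector pi /\
  forall pi', prob_vector pi' -> (trV M b r pi <= trV M b r pi')%E.

Definition mVc_weight (R : realType) (m n p : nat) (M : gee_model R m n p)
    (b : 'cV[R]_p) (i : 'I_m) : R :=
  norm2 (invmx (Phi0 M b) *m (Dmx M i b)^T *m invmx (Wmx M i b) *m resid M i b).

Definition pi_mVc (R : realType) (m n p : nat) (M : gee_model R m n p)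
    (b : 'cV[R]_p) (i : 'I_m) : R :=
  mVc_weight M b i / \sum_k mVc_weight M b k.

(* Main.v *)
(* With u_i = D_i^T W_i^-1 S_i, symmetry of W_i makes the numerators of Phi(pi)
   equal to u_i u_i^T, so tr V(pi) is, up to a nonnegative factor, the sum of
   a_i^2 / pi_i where a_i = |Phi_0^-1 u_i|.  Minimising this over the simplex is
   the Cauchy-Schwarz inequality (sum a_i)^2 <= sum a_i^2 / pi_i, with equality
   when pi is proportional to a. *)
Require Import Defs.
From HB Require Import structures.
From mathcomp Require Import all_boot all_order all_algebra.
From mathcomp Require Import all_classical all_reals all_analysis.
From mathcomp Require Import ring lra.
Import Order.TTheory GRing.Theory Num.Theory.
Import numFieldNormedType.Exports.
Local Open Scope ring_scope.

Lemma norm2_ge0 (R : realType) (p : nat) (v : 'cV[R]_p) : 0 <= norm2 v.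
Proof. exact: sqrtr_ge0. Qed.

Lemma norm2_eq0 (R : realType) (p : nat) (v : 'cV[R]_p) :
  (norm2 v == 0) = (v == 0).
Proof.
apply/idP/eqP => [|->]; last first.
  by rewrite /norm2 big1 ?sqrtr0 // => k _; rewrite mxE expr0n.
have sq_ge0 k : true -> 0 <= v k 0 ^+ 2 by rewrite sqr_ge0.
(* [sqrtr_eq0] only gives that the sum is at most 0; nonnegativity of the squares turns this into
   equality. *)
rewrite sqrtr_eq0 le_eqVlt ltNge sumr_ge0 // orbF psumr_eq0 // => /allP v0.
apply/colP => k; apply/eqP; rewrite mxE -sqrf_eq0.
exact: v0 (mem_index_enum k).
Qed.

Lemma mxtrace_mul_tr (R : realType) (p : nat) (v : 'cV[R]_p) :
  \tr (v *m v^T) = norm2 v ^+ 2.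
Proof.
rewrite sqr_sqrtr; last by apply: sumr_ge0 => k _; rewrite sqr_ge0.
by apply: eq_bigr => k _; rewrite mxE big_ord1 mxE.
Qed.

(** With A the sum of the [a i], the unit mass of [pi] spreads A^2 over the indices as 2 A a_i - A^2
    pi_i. The inequality then holds term by term, with gap (a_i - A pi_i)^2 / pi_i. *)
Lemma sqr_sum_le_weighted (R : realFieldType) (m : nat) (a pi : 'I_m -> R) :
    (forall i, 0 <= pi i) -> \sum_i pi i = 1 ->
    (forall i, pi i = 0 -> a i = 0) ->
  (\sum_i a i) ^+ 2 <= \sum_i (pi i)^-1 * a i ^+ 2.
Proof.
move=> pi_ge0 pi_sum a0; set A := \sum_i a i.
have -> : A ^+ 2 = \sum_i (2 * A * a i - A ^+ 2 * pi i).
  by rewrite sumrB -!mulr_sumr pi_sum -/A; ring.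
apply: ler_sum => i _.
(* At [pi i = 0] both terms are 0, since [a i] vanishes too. *)
have [pi0|pi_neq0] := eqVneq (pi i) 0; first by rewrite pi0 a0 //; lra.
rewrite -subr_ge0.
have -> : (pi i)^-1 * a i ^+ 2 - (2 * A * a i - A ^+ 2 * pi i) =
    (pi i)^-1 * (a i - A * pi i) ^+ 2 by field.
by rewrite mulr_ge0 ?invr_ge0 ?sqr_ge0.
Qed.

Lemma sqr_sum_eq_weighted (R : realFieldType) (m : nat) (a : 'I_m -> R) :
  \sum_i (a i / \sum_k a k)^-1 * a i ^+ 2 = (\sum_i a i) ^+ 2.
Proof.
rewrite [RHS]expr2 mulr_suml; apply: eq_bigr => i _; rewrite invf_div.
have [->|a_neq0] := eqVneq (a i) 0; first by rewrite expr0n mulr0 mul0r.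
by rewrite expr2 mulrA divfK // mulrC.
Qed.

Lemma Wmx_sym (R : realType) (m n p : nat) (M : gee_model R m n p) (i : 'I_m)
    (b : 'cV[R]_p) : (wcorr M)^T = wcorr M -> (Wmx M i b)^T = Wmx M i b.
Proof.
move=> C_sym; have A_sym : (Ahalf M i b)^T = Ahalf M i b.
  by rewrite /Ahalf map_trmx tr_diag_mx.
by rewrite /Wmx linearZ /= !trmx_mul A_sym C_sym mulmxA.
Qed.

Lemma Phi_numE (R : realType) (m n p : nat) (M : gee_model R m n p)
    (b : 'cV[R]_p) (i : 'I_m)
    (u := (Dmx M i b)^T *m invmx (Wmx M i b) *m resid M i b) :
  (wcorr M)^T = wcorr M -> Phi_num M b i = u *m u^T.
Proof.
move=> C_sym.
by rewrite /u !trmx_mul trmxK trmx_inv Wmx_sym // /Phi_num !mulmxA.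
Qed.

(** Translates the test for an infinite trace in [trV] into one on the scalar weights: u u^T has
    trace |u|^2, so it vanishes only with u, and Phi_0^-1 is injective. *)
Lemma Phi_num_eq0 (R : realType) (m n p : nat) (M : gee_model R m n p)
    (b : 'cV[R]_p) (i : 'I_m) :
    (wcorr M)^T = wcorr M -> Phi0 M b \in unitmx ->
  (Phi_num M b i == 0) = (mVc_weight M b i == 0).
Proof.
move=> C_sym P_unit; rewrite Phi_numE // /mVc_weight norm2_eq0.
rewrite -2!(mulmxA (invmx (Phi0 M b))); set u := _ *m resid M i b.
have -> : (invmx (Phi0 M b) *m u == 0) = (u == 0).
  apply/eqP/eqP => [Pu0|->]; last by rewrite mulmx0.
  by rewrite -[u](mulKVmx P_unit) Pu0 mulmx0.
apply/eqP/eqP => [uu0|->]; last by rewrite mul0mx.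
by apply/eqP; rewrite -norm2_eq0 -sqrf_eq0 -mxtrace_mul_tr uu0 mxtrace0.
Qed.

(** Conjugation by Phi_0^-1 keeps each summand of rank at most one, namely v v^T with v = Phi_0^-1
    u_i, whose trace is |v|^2. Both sides read 1/0 as 0. *)
Lemma mxtrace_V (R : realType) (m n p : nat) (M : gee_model R m n p)
    (b : 'cV[R]_p) (r : nat) (pi : 'I_m -> R) :
    (wcorr M)^T = wcorr M ->
  \tr (V M b r pi) = (r%:R * Nconst R m n ^+ 2)^-1 *
    \sum_i (pi i)^-1 * mVc_weight M b i ^+ 2.
Proof.
move=> C_sym; rewrite /V /Phi -scalemxAr -scalemxAl mxtraceZ; congr (_ * _).
rewrite mulmx_sumr mulmx_suml raddf_sum; apply: eq_bigr => i _ /=.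
rewrite -scalemxAr -scalemxAl mxtraceZ Phi_numE // -mxtrace_mul_tr.
by rewrite !trmx_mul !mulmxA.
Qed.

Theorem theorem3p3 (R : realType) (m n p r : nat) (M : gee_model R m n p)
    (b : 'cV[R]_p)
    (r_ge1 : (1 <= r)%N)
    (link_diff : forall t : R, derivable (link M) t 1)
    (varfun_pos : forall t : R, 0 < varfun M (link M t))
    (disp_pos : 0 < disp M)
    (wcorr_corr : correlation_matrix (wcorr M))
    (wcorr_unit : wcorr M \in unitmx)
    (b_root : score M b = 0)
    (score_diff : has_partials (score M) b)
    (Phi0_unit : Phi0 M b \in unitmx)
    (denom_pos : 0 < \sum_k mVc_weight M b k) :
  mVc_optimal M b r (pi_mVc M b).
Proof.
have [C_sym _ _] := wcorr_corr.
set a := mVc_weight M b; have a_ge0 i : 0 <= a i by exact: norm2_ge0.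
have A_neq0 : \sum_k a k != 0 by rewrite gt_eqF.
split.
  split=> [i|]; first by rewrite divr_ge0 // ltW.
  by rewrite -mulr_suml divff.
move=> pi' [pi'_ge0 pi'_sum]; rewrite /trV.
(* The proposed probabilities vanish only where the weight does, so their trace is finite. *)
have -> : [exists i, (Phi_num M b i != 0) && (pi_mVc M b i == 0)] = false.
  apply/existsP => -[i]; rewrite Phi_num_eq0 // => /andP[a_neq0].
  by rewrite mulf_eq0 invr_eq0 (negPf a_neq0) (negPf A_neq0).
(* A competitor with infinite trace loses at once; any other has [pi' i = 0] only where [a i = 0],
   as the weighted inequality requires. *)
case: ifPn => [_|/existsPn pi'0]; first by rewrite leey.
rewrite lee_fin !mxtrace_V // ler_wpM2l //.
  by rewrite invr_ge0 mulr_ge0 ?ler0n ?sqr_ge0.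
rewrite sqr_sum_eq_weighted; apply: sqr_sum_le_weighted => // i pi0.
by have := pi'0 i; rewrite Phi_num_eq0 // pi0 eqxx andbT negbK => /eqP.
Qed.
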